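(* Let $\mathbb K$ be a field of characteristic $0$, let $R=\mathbb K[x_1,\ldots,x_k]$ with the standard grading, and let $\mathcal A=\{\ell_1,\ldots,\ell_n\}\subset R$, $n\ge 2$, be a hyperplane arrangement, i.e. a collection of $n$ linear forms no two of which are proportional. Put $m:=\binom n2$ and let $p(\mathcal A)$ be the number of independent 3-dependencies of $\mathcal A$. Then the $R$-module $R/I_{n-2}(\mathcal A)$ has the graded linear free resolution $$0\rightarrow R^{m-n-p(\mathcal A)+1}(-n)\rightarrow R^{2m-n-2p(\mathcal A)}(-(n-1))\rightarrow R^{m-p(\mathcal A)}(-(n-2))\rightarrow R\rightarrow R/I_{n-2}(\mathcal A)\rightarrow 0.$$
   Context: Ideals of fold products: for an integer $1\le a\le n$, $I_a(\mathcal A)$ is the ideal of $R$ generated by all products $\ell_{i_1}\cdots\ell_{i_a}$ with $1\le i_1<\cdots<i_a\le n$; by convention $I_0(\mathcal A)=R$. 3-dependencies: a 3-dependency of $\mathcal A$ is a relation $c_{i_1}\ell_{i_1}+c_{i_2}\ell_{i_2}+c_{i_3}\ell_{i_3}=0$ with $1\le i_1<i_2<i_3\le n$ and $c_{i_1},c_{i_2},c_{i_3}\in\mathbb K\setminus\{0\}$. The set $\{i_1,i_2,i_3\}$ is then called a circuit (of size 3), and the coefficients are determined up to a common nonzero scalar. The number $p(\mathcal A)$: index the coordinates of $\mathbb K^m$, $m=\binom n2$, by the pairs $(i,j)$ with $1\le i<j\le n$. To each 3-dependency $c_{i_1}\ell_{i_1}+c_{i_2}\ell_{i_2}+c_{i_3}\ell_{i_3}=0$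 of $\mathcal A$ (with $1\le i_1<i_2<i_3\le n$ and $c_{i_1},c_{i_2},c_{i_3}\in\mathbb K\setminus\{0\}$) associate the vector ${\bf c}_{i_1,i_2,i_3}\in\mathbb K^m$ whose $(i_1,i_2)$-entry is $c_{i_3}$, whose $(i_1,i_3)$-entry is $c_{i_2}$, whose $(i_2,i_3)$-entry is $c_{i_1}$, and whose other entries are $0$. Let $\mathcal V(\mathcal A)\subseteq\mathbb K^m$ be the $\mathbb K$-linear span of all these vectors, over all 3-dependencies of $\mathcal A$, and $p(\mathcal A):=\dim_{\mathbb K}\mathcal V(\mathcal A)$. $R^b(-c)$ denotes the direct sum of $b$ copies of $R$ with grading shifted by $-c$; all maps are graded of degree $0$. *)

(* Defs.v *)
From HB Require Import structures.
From mathcomp Require Import all_boot all_order all_algebra.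
From mathcomp Require Import generic_quotient ring_quotient.
From mathcomp Require Import boolp.
From mathcomp Require Import mpoly.

Set Implicit Arguments.
Unset Strict Implicit.
Unset Printing Implicit Defensive.

Import GRing.Theory.
Local Open Scope ring_scope.
Local Open Scope quotient_scope.

(* Linear span of an arbitrary (possibly infinite) set of vectors: the least
   subspace containing it. *)

Lemma vspan_ex (K : fieldType) (V : vectType K) (S : V -> Prop) :
  exists U : {vspace V},
    (forall v, S v -> v \in U) /\
    (forall W : {vspace V}, (forall v, S v -> v \in W) -> (U <= W)%VS).
Proof.
pose P (d : nat) := `[< exists U : {vspace V}, \dim U = d /\
  forall W : {vspace V}, (forall v, S v -> v \in W) -> (U <= W)%VS >].
have P0 : exists d, P d.
  by exists 0%N; apply/asboolP; exists 0%VS; split=> [|W _]; rewrite ?dimv0 ?sub0v.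
have Pub d : P d -> (d <= \dim {:V})%N.
  by case/asboolP=> U [<- _]; rewrite dimvS ?subvf.
case: (ex_maxnP P0 Pub) => d /asboolP[U [dU minU]] maxd.
exists U; split=> // v Sv; apply: contraT => vU.
have PUv : P (\dim (U + <[v]>)%VS).
  apply/asboolP; exists (U + <[v]>)%VS; split=> // W SW.
  by rewrite subv_add minU //= -memvE SW.
have eqU : U = (U + <[v]>)%VS.
  by apply/eqP; rewrite eqEdim addvSl dU maxd.
by move: vU; rewrite eqU (subvP (addvSr U <[v]>)) ?memv_line.
Qed.

Definition vspan (K : fieldType) (V : vectType K) (S : V -> Prop) : {vspace V} :=
  projT1 (cid (vspan_ex S)).

Lemma vspanP (K : fieldType) (V : vectType K) (S : V -> Prop) :
  (forall v, S v -> v \in vspan S) /\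
  (forall W : {vspace V}, (forall v, S v -> v \in W) -> (vspan S <= W)%VS).
Proof. by rewrite /vspan; case: cid. Qed.

(* The ideal generated by a finite family, as a boolean predicate so that the
   library's quotients apply to it. *)

Definition ideal_gen (R : comNzRingType) (I : finType) (g : I -> R) : {pred R} :=
  fun f => `[< exists c : I -> R, f = \sum_i c i * g i >].

Lemma ideal_genP (R : comNzRingType) (I : finType) (g : I -> R) f :
  reflect (exists c : I -> R, f = \sum_i c i * g i) (f \in ideal_gen g).
Proof. exact: asboolP. Qed.

Lemma ideal_gen_mem (R : comNzRingType) (I : finType) (g : I -> R) i :
  g i \in ideal_gen g.
Proof.
apply/ideal_genP; exists (fun j => (j == i)%:R).
rewrite (bigD1 i) //= eqxx mul1r big1 ?addr0 // => j /negPf ->.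
by rewrite mul0r.
Qed.

Lemma ideal_gen_zmod_closed (R : comNzRingType) (I : finType) (g : I -> R) :
  zmod_closed (ideal_gen g).
Proof.
split=> [|_ _ /ideal_genP[c ->] /ideal_genP[e ->]]; apply/ideal_genP.
  by exists (fun=> 0); rewrite big1 // => i _; rewrite mul0r.
exists (fun i => c i - e i); rewrite -sumrB.
by apply: eq_bigr => i _; rewrite mulrBl.
Qed.

HB.instance Definition _ (R : comNzRingType) (I : finType) (g : I -> R) :=
  GRing.isZmodClosed.Build R (ideal_gen g) (ideal_gen_zmod_closed g).

Lemma ideal_genM (R : comNzRingType) (I : finType) (g : I -> R) a f :
  f \in ideal_gen g -> a * f \in ideal_gen g.
Proof.
case/ideal_genP=> c ->; apply/ideal_genP; exists (fun i => a * c i).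
by rewrite big_distrr /=; apply: eq_bigr => i _; rewrite mulrA.
Qed.

(* The quotient module R / (g).  The library's ring quotient {ideal_quot _}
   only covers proper ideals, whereas the unit ideal is needed here; so we take
   the quotient of additive groups and equip it with its R-module structure. *)

Definition quot_mod (R : comNzRingType) (I : finType) (g : I -> R) : Type :=
  Quotient.quot (ideal_gen g).

HB.instance Definition _ (R : comNzRingType) (I : finType) (g : I -> R) :=
  GRing.Zmodule.on (quot_mod g).

Definition quot_pi (R : comNzRingType) (I : finType) (g : I -> R) (f : R^o) :
  quot_mod g := \pi_(Quotient.quot (ideal_gen g)) f.

Definition quot_scale (R : comNzRingType) (I : finType) (g : I -> R)
  (a : R) (x : quot_mod g) : quot_mod g :=
  quot_pi g (a * (repr (x : Quotient.quot (ideal_gen g)))).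

Lemma quot_pi_eq (R : comNzRingType) (I : finType) (g : I -> R) (f h : R) :
  quot_pi g f = quot_pi g h <-> f - h \in ideal_gen g.
Proof.
rewrite Quotient.idealrBE; split=> [fh|/eqP //]; exact/eqP.
Qed.

Lemma quot_piB (R : comNzRingType) (I : finType) (g : I -> R) :
  zmod_morphism (quot_pi g).
Proof. by move=> x y; rewrite /quot_pi raddfB. Qed.

Lemma quot_pi_surj (R : comNzRingType) (I : finType) (g : I -> R) (x : quot_mod g) :
  exists f : R, quot_pi g f = x.
Proof. by exists (repr (x : Quotient.quot (ideal_gen g))); exact: reprK. Qed.

Lemma quot_scale_pi (R : comNzRingType) (I : finType) (g : I -> R) (a f : R) :
  quot_scale a (quot_pi g f) = quot_pi g (a * f).
Proof.
apply/quot_pi_eq; rewrite -mulrBr; apply: ideal_genM; apply/quot_pi_eq.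
exact: reprK.
Qed.

HB.instance Definition _ (R : comNzRingType) (I : finType) (g : I -> R) :=
  GRing.isZmodMorphism.Build R^o (quot_mod g) (quot_pi g) (@quot_piB R I g).

Lemma quot_scaleA (R : comNzRingType) (I : finType) (g : I -> R) (a b : R)
  (x : quot_mod g) : quot_scale a (quot_scale b x) = quot_scale (a * b) x.
Proof. by case: (quot_pi_surj x) => f <-; rewrite !quot_scale_pi mulrA. Qed.

Lemma quot_scale1 (R : comNzRingType) (I : finType) (g : I -> R) :
  left_id 1 (@quot_scale R I g).
Proof. by move=> x; case: (quot_pi_surj x) => f <-; rewrite quot_scale_pi mul1r. Qed.

Lemma quot_scaleDr (R : comNzRingType) (I : finType) (g : I -> R) :
  right_distributive (@quot_scale R I g) +%R.
Proof.
move=> a x y; case: (quot_pi_surj x) => f <-; case: (quot_pi_surj y) => h <-.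
by rewrite -raddfD !quot_scale_pi -raddfD -mulrDr.
Qed.

Lemma quot_scaleDl (R : comNzRingType) (I : finType) (g : I -> R) (x : quot_mod g) :
  {morph (@quot_scale R I g)^~ x : a b / a + b}.
Proof.
move=> a b; case: (quot_pi_surj x) => f <-.
by rewrite !quot_scale_pi -raddfD -mulrDl.
Qed.

HB.instance Definition _ (R : comNzRingType) (I : finType) (g : I -> R) :=
  GRing.Zmodule_isLmodule.Build R (quot_mod g) (@quot_scaleA R I g)
    (@quot_scale1 R I g) (@quot_scaleDr R I g) (@quot_scaleDl R I g).

Lemma quot_piZ (R : comNzRingType) (I : finType) (g : I -> R) :
  scalable (quot_pi g).
Proof. by move=> a f; rewrite -quot_scale_pi. Qed.

HB.instance Definition _ (R : comNzRingType) (I : finType) (g : I -> R) :=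
  GRing.isScalable.Build R R^o (quot_mod g) *:%R (quot_pi g) (@quot_piZ R I g).

(* Graded pieces, in all integer degrees: R_d (zero for d < 0),
   (R^b(-c))_d = (R_(d - c))^b, and (R/I)_d = image of R_d. *)

Definition homog_ring (K : fieldType) (k : nat) (d : int) (f : {mpoly K[k]}) : Prop :=
  if d is Posz e then f \is e.-homog else f = 0.

Definition homog_free (K : fieldType) (k b c : nat) (d : int)
  (v : 'rV[{mpoly K[k]}]_b) : Prop :=
  forall j, homog_ring (d - c%:Z) (v 0 j).

Definition homog_quot (K : fieldType) (k : nat) (I : finType)
  (g : I -> {mpoly K[k]}) (d : int) (x : quot_mod g) : Prop :=
  exists2 f, homog_ring d f & quot_pi g f = x.

Definition degree0 (M N : Type) (hM : int -> M -> Prop) (hN : int -> N -> Prop)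
  (f : M -> N) : Prop :=
  forall d v, hM d v -> hN d (f v).

Definition exact_at (R : nzRingType) (M N P : lmodType R) (f : M -> N) (h : N -> P) :
  Prop := forall v, h v = 0 <-> exists u, f u = v.

(* 0 -> R^b3(-c3) -> R^b2(-c2) -> R^b1(-c1) -> R -> R/(g) -> 0, where
   R -> R/(g) is the canonical projection. *)
Definition has_graded_resolution (K : fieldType) (k : nat) (I : finType)
  (g : I -> {mpoly K[k]}) (b3 c3 b2 c2 b1 c1 : nat) : Prop :=
  exists (d3 : {linear 'rV[{mpoly K[k]}]_b3 -> 'rV[{mpoly K[k]}]_b2})
         (d2 : {linear 'rV[{mpoly K[k]}]_b2 -> 'rV[{mpoly K[k]}]_b1})
         (d1 : {linear 'rV[{mpoly K[k]}]_b1 -> {mpoly K[k]}^o}),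
    [/\ degree0 (homog_free c3) (homog_free c2) d3,
        degree0 (homog_free c2) (homog_free c1) d2,
        degree0 (homog_free c1) (@homog_ring K k) d1
      & degree0 (@homog_ring K k) (@homog_quot K k I g) (quot_pi g)] /\
    [/\ injective d3,
        exact_at d3 d2,
        exact_at d2 d1,
        exact_at d1 (quot_pi g)
      & forall x : quot_mod g, exists f, quot_pi g f = x].

Definition arrangement (K : fieldType) (k n : nat) (l : 'I_n -> {mpoly K[k]}) : Prop :=
  [/\ forall i, l i \is 1.-homog,
      forall i, l i != 0
    & forall i j, i != j -> forall c : K, l i != c *: l j].

(* Generators of I_a(A); for a = 0 this is the empty product 1, so that
   I_0(A) = R. *)
Definition fold_products (K : fieldType) (k n : nat) (l : 'I_n -> {mpoly K[k]})
  (a : nat) (S : {S : {set 'I_n} | #|S| == a}) : {mpoly K[k]} :=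
  \prod_(i in val S) l i.
Arguments fold_products {K k n} l a S.

Definition dep3 (K : fieldType) (k n : nat) (l : 'I_n -> {mpoly K[k]})
  (i1 i2 i3 : 'I_n) (c1 c2 c3 : K) : Prop :=
  [/\ (i1 < i2 < i3)%N, [/\ c1 != 0, c2 != 0 & c3 != 0]
    & c1 *: l i1 + c2 *: l i2 + c3 *: l i3 = 0].

(* Index set of the coordinates of K^m, m = 'C(n, 2). *)
Definition pairs (n : nat) := {ij : 'I_n * 'I_n | (ij.1 < ij.2)%N}.

Lemma card_pairs n : #|{: pairs n}| = 'C(n, 2).
Proof.
rewrite card_sig -(card_ltn_sorted_tuples 2 n).
pose f (t : 2.-tuple 'I_n) := (tnth t 0, tnth t 1).
pose h (ij : 'I_n * 'I_n) : 2.-tuple 'I_n := [tuple ij.1; ij.2].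
have hK : cancel h f by case.
rewrite -(card_image (can_inj hK)); apply: eq_card => t; rewrite !inE.
apply/imageP/idP => [[[i j] /= lt_ij ->]|] /=; first by rewrite andbT.
case: t => [[|i [|j [|? ?]]] // sz] /=; rewrite andbT => lt_ij.
by exists (i, j) => //; apply/val_inj.
Qed.

Definition dep3_vec (K : fieldType) (n : nat) (i1 i2 i3 : 'I_n) (c1 c2 c3 : K) :
  {ffun pairs n -> K^o} :=
  [ffun ij : pairs n =>
     if val ij == (i1, i2) then c3
     else if val ij == (i1, i3) then c2
     else if val ij == (i2, i3) then c1
     else 0].

Definition dep3_space (K : fieldType) (k n : nat) (l : 'I_n -> {mpoly K[k]}) :
  {vspace {ffun pairs n -> K^o}} :=
  vspan (fun v => exists (i1 i2 i3 : 'I_n) (c1 c2 c3 : K),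
           dep3 l i1 i2 i3 c1 c2 c3 /\ v = dep3_vec i1 i2 i3 c1 c2 c3).

Definition dep3_rank (K : fieldType) (k n : nat) (l : 'I_n -> {mpoly K[k]}) : nat :=
  \dim (dep3_space l).

(* Main.v *)
From HB Require Import structures.
Require Import Defs.
From mathcomp Require Import all_boot all_order all_algebra.
From mathcomp Require Import boolp ring zify.
From mathcomp Require Import mpoly.
Set Implicit Arguments.
Unset Strict Implicit.
Unset Printing Implicit Defensive.
Import GRing.Theory.
Local Open Scope ring_scope.

(** Write [P_ij] for the product of all the forms except [l_i] and [l_j], and
    [P_h] for the product of all the forms except [l_h].  The ideal is generated
    by the [P_ij]; dividing by the product of all the forms, it is the module
    generated by the fractions [1/(l_i l_j)], and a 3-dependency divided by
    [l_1 l_2 l_3] is a linear relation between three of these.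

    A basis over [K] of the span of these generators is indexed by the pairs
    [i < j] without broken circuit: no [h < i] with [l_h] in the span of [l_i]
    and [l_j].  If such an [h] exists, the 3-dependency on [h, i, j] rewrites
    [P_ij] in terms of two pairs with a smaller first index; so the 3-dependency
    vectors together with the coordinate vectors of these basic pairs span
    [K^m].  That the sum is direct follows from the key fact [nbc_syzygy]: in a
    syzygy of the basic [P_ij] over [R], the coefficient of [P_ij] lies in the
    ideal [(l_i, l_j)].  Hence there are [N = m - p] basic pairs
    ([dep3_rankE]).

    For each basic pair take the Koszul complex of [(l_i, l_j)].  The sum of
    these complexes, [R^N -> R^2N -> R^N], maps to [R^n -> R^n], the diagonal
    matrix of the forms, by constant matrices: [l_i P_ij = P_j] suggests
    sending the two degree-1 generators of the pair [ij] to [e_j] and [e_i],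
    and the degree-2 generator must then go to [e_i - e_j].  The first of these
    constant matrices has rank [n]; the second is the boundary matrix of a
    connected graph on [n] vertices, of rank [n - 1].  Their kernels are
    therefore free of ranks [2N - n] and [N - n + 1], and
    [0 -> ker -> ker -> R^N] is the resolution.

    Exactness is a diagram chase.  At [R^N], a syzygy of the [P_ij] is by
    [nbc_syzygy] a Koszul boundary [w koszul1]; the image of [w] in [R^n] is a
    syzygy of the [P_h], and these come from the vectors of coordinate sum zero
    through the diagonal matrix ([omit1_exact]), so [w] can be corrected by a
    Koszul boundary to lie in the kernel.  In the middle, an element of the
    kernel which is a cycle is a Koszul boundary [u koszul2], and [u] is in the
    kernel because the diagonal matrix is injective.  The grading is right because
    the entries of the three differentials are homogeneous of degrees [1], [1]
    and [n - 2]. *)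

(** * Ideals generated by one or two linear forms *)

Section LinearForms.
Variables (K : fieldType) (k : nat).
Notation R := {mpoly K[k]}.

Lemma linear_formE (h : R) : h \is 1.-homog -> h = \sum_(s < k) h@_(U_(s)) *: 'X_s.
Proof.
move=> hh; apply/mpolyP=> m; rewrite raddf_sum /=.
case: (boolP (mdeg m == 1%N)) => [|m1].
  rewrite mdeg_eq1 => /existsP[i /eqP ->].
  rewrite (bigD1 i) //= mcoeffZ mcoeffXU eqxx mulr1 big1 ?addr0 // => j ji.
  by rewrite mcoeffZ mcoeffXU (negPf ji) mulr0.
rewrite (dhomog_nemf_coeff hh m1) big1 // => j _.
rewrite mcoeffZ mcoeffX; case: eqP => [em|]; rewrite ?mulr0 //.
by move: m1; rewrite -em mdeg1.
Qed.

(** Substituting for one variable of [l] so as to kill [l] yields a retraction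
    whose kernel is the ideal [(l)]; its image being a domain, [(l)] is prime. *)
Lemma elimination (l : R) : l \is 1.-homog -> l != 0 ->
  exists pi : {rmorphism R -> R},
    [/\ pi l = 0, forall c, pi c%:MP = c%:MP, forall f, exists g, f = pi f + g * l
      & forall h, h \is 1.-homog -> exists c : K, pi h = h - c *: l].
Proof.
move=> hl nzl.
have [s0 nzs] : exists s, l@_(U_(s)) != 0.
  apply/existsP; apply: contraR nzl; rewrite negb_exists => /forallP l0.
  rewrite (linear_formE hl) big1 // => s _.
  by move: (l0 s); rewrite negbK => /eqP ->; rewrite scale0r.
(* only the variable s0, which occurs in l, is moved *)
pose q := [tuple 'X_s - ((s == s0)%:R / l@_(U_(s0))) *: l | s < k].
have [pi [piX piZ piC]] : exists pi : {rmorphism R -> R},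
    [/\ forall s, pi 'X_s = 'X_s - ((s == s0)%:R / l@_(U_(s0))) *: l,
        forall c f, pi (c *: f) = c *: pi f & forall c, pi c%:MP = c%:MP].
  exists (comp_mpoly q); split=> *; rewrite /= ?comp_mpolyZ ?comp_mpolyC //.
  by rewrite comp_mpolyXU -tnth_nth tnth_mktuple.
have piL h : h \is 1.-homog -> pi h = h - (h@_(U_(s0)) / l@_(U_(s0))) *: l.
  move=> hh; rewrite [in LHS](linear_formE hh) rmorph_sum.
  under eq_bigr => s _ do rewrite piZ piX scalerBr scalerA.
  rewrite sumrB -linear_formE // -scaler_suml; congr (_ - _ *: _).
  rewrite (bigD1 s0) //= eqxx div1r big1 ?addr0 // => s /negPf ->.
  by rewrite mul0r mulr0.
exists pi; split.
- by rewrite piL // divff // scale1r subrr.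
- exact: piC.
- move=> f; rewrite [f]mpolyE.
  pose P (f : R) := exists g, f = pi f + g * l.
  have PD f1 f2 : P f1 -> P f2 -> P (f1 + f2).
    move=> [g1 e1] [g2 e2]; exists (g1 + g2).
    by rewrite rmorphD mulrDl addrACA -e1 -e2.
  have PM f1 f2 : P f1 -> P f2 -> P (f1 * f2).
    move=> [g1 e1] [g2 e2]; exists (g1 * f2 + pi f1 * g2).
    by rewrite {1}e1 {1}e2 rmorphM [in X in _ = _ + X]e2; ring.
  have PC c : P c%:MP by exists 0; rewrite mul0r addr0 piC.
  have PX s : P 'X_s.
    exists ((s == s0)%:R / l@_(U_(s0)))%:MP.
    by rewrite piX mul_mpolyC subrK.
  apply: (big_ind P) => [|f1 f2|m _].
  + by rewrite -mpolyC0.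
  + exact: PD.
  rewrite -mul_mpolyC; apply: (PM) => //; rewrite mpolyXE_id.
  apply: (big_ind P) => [|f1 f2|s _]; [by rewrite -mpolyC1 | exact: PM|].
  by elim: (m s) => [|e IH]; rewrite ?expr0 -?mpolyC1 ?exprS //; exact: PM.
- by move=> h hh; exists (h@_(U_(s0)) / l@_(U_(s0))); rewrite piL.
Qed.

(** Two successive eliminations exhibit [(l1, l2)] as the kernel of a ring
    endomorphism, so that it is prime, and show that it contains no linear form
    outside the plane spanned by [l1] and [l2]. *)
Lemma plane_elimination (l1 l2 : R) :
    l1 \is 1.-homog -> l2 \is 1.-homog -> l1 != 0 ->
    (forall c : K, l2 != c *: l1) ->
  exists pi : {rmorphism R -> R},
    [/\ pi l1 = 0, pi l2 = 0, forall c, pi c%:MP = c%:MP,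
        forall f, exists g1 g2, f = pi f + (g1 * l1 + g2 * l2)
      & forall h, h \is 1.-homog -> pi h = 0 ->
          exists c d : K, h = c *: l1 + d *: l2].
Proof.
move=> h1 h2 nz1 npr.
have [p1 [p1l1 p1C p1E p1L]] := elimination h1 nz1.
have [c0 p1l2] := p1L _ h2.
have nz2 : p1 l2 != 0 by rewrite p1l2 subr_eq0.
have h2' : p1 l2 \is 1.-homog by rewrite p1l2 rpredB ?rpredZ.
have [p2 [p2l2 p2C p2E p2L]] := elimination h2' nz2.
exists (p2 \o p1); split=> /=.
- by rewrite p1l1 rmorph0.
- exact: p2l2.
- by move=> c; rewrite p1C.
- move=> f; have [g eg] := p1E f; have [g' eg'] := p2E (p1 f).
  exists (g - g' * c0%:MP), g'.
  by rewrite {1}eg {1}eg' p1l2 -mul_mpolyC; ring.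
- move=> h hh ph; have [c ec] := p1L _ hh.
  have hh' : p1 h \is 1.-homog by rewrite ec rpredB ?rpredZ.
  have [d ed] := p2L _ hh'.
  have {}ed : p1 h = d *: p1 l2 by apply/eqP; rewrite -subr_eq0 -ed ph.
  exists (c - d * c0), d; move/eqP: ed; rewrite ec subr_eq => /eqP ->.
  by rewrite p1l2 scalerBr scalerA scalerBl addrC addrA -addrA (addrC (d *: l2)) addrA.
Qed.

Lemma linear_form_prime (l f g h : R) : l \is 1.-homog -> l != 0 ->
  f * g = h * l -> ~ (exists f', f = f' * l) -> exists g', g = g' * l.
Proof.
move=> hl nzl efg nf; have [p [pl _ pE _]] := elimination hl nzl.
have /eqP : p f * p g = 0 by rewrite -rmorphM efg rmorphM pl mulr0.
rewrite mulf_eq0 => /orP[] /eqP p0.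
  by case: nf; have [f' ef] := pE f; exists f'; rewrite {1}ef p0 add0r.
by have [g' eg] := pE g; exists g'; rewrite {1}eg p0 add0r.
Qed.

Lemma linear_form_ndvd (l h : R) : l \is 1.-homog -> l != 0 ->
  h \is 1.-homog -> (forall c : K, h != c *: l) -> ~ (exists g, h = g * l).
Proof.
move=> hl nzl hh npr [g eg]; have [p [pl _ _ pL]] := elimination hl nzl.
have [c ec] := pL _ hh; case/eqP: (npr c).
by apply/eqP; rewrite -subr_eq0 -ec eg rmorphM pl mulr0.
Qed.

Lemma linear_form_ndvd_prod (l : R) (I : finType) (P : pred I) (F : I -> R) :
  l \is 1.-homog -> l != 0 -> (forall i, P i -> ~ (exists g, F i = g * l)) ->
  ~ (exists g, \prod_(i | P i) F i = g * l).
Proof.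
move=> hl nzl nF.
apply: (big_ind (fun f => ~ exists g, f = g * l)) => [[g eg]|f g nf ng [h eh]|//].
  have [p [pl _ _ _]] := elimination hl nzl.
  have /eqP : p 1 = 0 by rewrite eg rmorphM pl mulr0.
  by rewrite rmorph1 oner_eq0.
by apply: ng; apply: linear_form_prime eh nf.
Qed.

Lemma koszul_exact (l1 l2 a b : R) :
    l1 \is 1.-homog -> l2 \is 1.-homog -> l1 != 0 ->
    (forall c : K, l2 != c *: l1) ->
  a * l1 + b * l2 = 0 -> exists u, a = - (u * l2) /\ b = u * l1.
Proof.
move=> h1 h2 nz1 npr e.
have e' : l2 * b = (- a) * l1.
  by apply/eqP; rewrite mulNr -addr_eq0 addrC [l2 * b]mulrC e.
have [u eu] := linear_form_prime h1 nz1 e' (linear_form_ndvd h1 nz1 h2 npr).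
exists u; split=> //; apply: (mulIf nz1); move: e'; rewrite eu => e'.
by rewrite -[LHS]opprK -mulNr -e'; ring.
Qed.
End LinearForms.

(** * Pairs without broken circuit *)

Definition src n (x : pairs n) : 'I_n := (val x).1.
Definition tgt n (x : pairs n) : 'I_n := (val x).2.
Arguments src {n} x.
Arguments tgt {n} x.

Lemma src_lt_tgt n (x : pairs n) : (src x < tgt x)%N.
Proof. exact: valP x. Qed.

Lemma src_neq_tgt n (x : pairs n) : src x != tgt x.
Proof. by have := src_lt_tgt x; rewrite ltn_neqAle => /andP[]. Qed.

Section Arrangement.
Variables (K : fieldType) (k n : nat) (l : 'I_n -> {mpoly K[k]}).
Notation R := {mpoly K[k]}.

Definition in_pencil (a b h : 'I_n) : bool :=
  `[< exists c d : K, l h = c *: l a + d *: l b >].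

(** The two-element sets containing no broken circuit for the order of the
    indices: in each rank-2 flat with least index [i] these are the pairs [(i, j)]
    with [j] another index of the flat.  In particular an index [j] other than
    the least lies in exactly one of them inside that flat. *)
Definition nbc (x : pairs n) : bool :=
  [forall h : 'I_n, (h < src x)%N ==> ~~ in_pencil (src x) (tgt x) h].

Definition omit1 (h : 'I_n) : R := \prod_(g | g != h) l g.
Definition omit2 (x : pairs n) : R :=
  \prod_(h | (h != src x) && (h != tgt x)) l h.

Lemma in_pencilC a b h : in_pencil a b h = in_pencil b a h.
Proof.
by apply/asboolP/asboolP => -[c [d e]]; exists d, c; rewrite addrC.
Qed.

Lemma in_pencil_l a b : in_pencil a b a.
Proof. by apply/asboolP; exists 1, 0; rewrite scale1r scale0r addr0. Qed.

Lemma in_pencil_r a b : in_pencil a b b.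
Proof. by rewrite in_pencilC in_pencil_l. Qed.

Hypothesis arrl : arrangement l.

Let hl i : l i \is 1.-homog. Proof. by case: arrl. Qed.
Let nzl i : l i != 0. Proof. by case: arrl. Qed.
Let npr i j : i != j -> forall c : K, l i != c *: l j.
Proof. by case: arrl => _ _; apply. Qed.

(** Exchange property: in a rank-2 flat any two of the forms span. *)
Lemma in_pencil_exchange a b h : h != b -> in_pencil a b h -> in_pencil h b a.
Proof.
move=> hb /asboolP[c [d e]]; have nzc : c != 0.
  by apply: contraNneq (npr hb d) => c0; rewrite e c0 scale0r add0r.
apply/asboolP; exists c^-1, (- (d / c)).
by rewrite e scalerDr !scalerA mulVf // scale1r scaleNr mulrC addrK.
Qed.

(** Two basic pairs which share the larger index of one of them lie in different
    rank-2 flats. *)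
Lemma nbc_pencil_tgt x y a : nbc x -> nbc y -> x != y ->
  ((val y == (a, tgt x)) || (val y == (tgt x, a))) ->
  ~~ in_pencil (src x) (tgt x) a.
Proof.
move=> /forallP nx /forallP ny xy yE; apply/negP => pa.
have lty := src_lt_tgt y; have ltx := src_lt_tgt x.
have ax : a != tgt x.
  by move: lty; apply: contraTneq => ax; move: yE; rewrite ax orbb /src /tgt => /eqP ->;
    rewrite ltnn.
have pe := in_pencil_exchange ax pa.
case/orP: yE => /eqP yE.
  have sy : src y = a by rewrite /src yE.
  have ty : tgt y = tgt x by rewrite {1}/tgt yE.
  case: (ltngtP a (src x)) => ha.
  - by move: (nx a); rewrite ha pa.
  - by move: (ny (src x)); rewrite sy ty ha pe.
  - case/eqP: xy; apply/val_inj; rewrite yE (val_inj ha); exact: surjective_pairing.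
have sy : src y = tgt x by rewrite {1}/src yE.
have ty : tgt y = a by rewrite /tgt yE.
by move: (ny (src x)); rewrite sy ty ltx in_pencilC pe.
Qed.

(** Work modulo [l_j], for [x = (i, j)], and let [X] be the flat of [x].  Only
    the [P_y] with [j] in [y] survive; for [y] other than [x] the other index
    of [y] is outside [X] by [nbc_pencil_tgt], so [P_y] is divisible by [l_i D],
    where [D] is the product of the forms of [X] other than [l_i] and [l_j],
    while [P_x] is [D] times the product [Q] of the forms outside [X].  Cancelling
    [D], which is prime to [l_j], leaves [f_x Q] in the prime ideal
    [(l_i, l_j)], which does not contain [Q]. *)
Lemma nbc_syzygy (f : pairs n -> R) :
  \sum_(x | nbc x) f x * omit2 x = 0 ->
  forall x, nbc x -> exists a b, f x = a * l (src x) + b * l (tgt x).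
Proof.
move=> sum0 x nx; set i := src x; set j := tgt x.
have ij : i != j by exact: src_neq_tgt.
have ji : j != i by rewrite eq_sym.
have [p [pi0 pj0 _ pE pL]] := plane_elimination (hl i) (hl j) (nzl i) (npr ji).
pose D := \prod_(b | [&& b != i, b != j & in_pencil i j b]) l b.
pose Q := \prod_(b | ~~ in_pencil i j b) l b.
have PDQ : omit2 x = D * Q.
  rewrite /omit2 (bigID (in_pencil i j)) /=; congr (_ * _).
    by apply: eq_bigl => b; rewrite andbA.
  apply: eq_bigl => b; case: (boolP (in_pencil i j b)); rewrite ?andbF ?andbT //.
  by move=> nb; apply/andP; split; apply: contraNneq nb => ->;
    rewrite ?in_pencil_l ?in_pencil_r.
have PO y : nbc y && (y != x) -> exists G H, omit2 y = G * (l i * D) + H * l j.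
  case/andP=> ny yx.
  case: (boolP ((j != src y) && (j != tgt y))) => [jy|].
    exists 0, (\prod_(b | ((b != src y) && (b != tgt y)) && (b != j)) l b).
    by rewrite mul0r add0r /omit2 (bigD1 j) //= mulrC.
  rewrite negb_and !negbK => jy.
  have [a aE] : exists a, (val y == (a, j)) || (val y == (j, a)).
    case/orP: jy => /eqP jE; [exists (tgt y)|exists (src y)];
    by rewrite jE /src /tgt -surjective_pairing eqxx ?orbT.
  have na : ~~ in_pencil i j a by apply: (nbc_pencil_tgt nx ny) => //; rewrite eq_sym.
  have yP b : (b != src y) && (b != tgt y) = (b != a) && (b != j).
    by rewrite /src /tgt; case/orP: aE => /eqP -> //=; rewrite andbC.
  exists (\prod_(b | (b != a) && (b != j) && ~~ in_pencil i j b) l b), 0.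
  rewrite mul0r addr0 /omit2 (eq_bigl _ _ yP) (bigID (in_pencil i j)) /= mulrC.
  congr (_ * _); rewrite (bigD1 i) /=; last first.
    by rewrite ij in_pencil_l !andbT; apply: contraNneq na => <-; rewrite in_pencil_l.
  congr (_ * _); apply: eq_bigl => b.
  case: (boolP (in_pencil i j b)); rewrite ?andbF // => pb.
  have -> : b != a by apply: contraNneq na => <-.
  by rewrite !andbT andTb andbC.
have [G [H GH]] : exists G H,
    \sum_(y | nbc y && (y != x)) f y * omit2 y = G * (l i * D) + H * l j.
  apply: (big_ind (fun g => exists G H, g = G * (l i * D) + H * l j)).
  - by exists 0, 0; rewrite !mul0r addr0.
  - move=> _ _ [G1 [H1 ->]] [G2 [H2 ->]]; exists (G1 + G2), (H1 + H2).
    by rewrite !mulrDl addrACA.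
  - by move=> y /PO[G [H ->]]; exists (f y * G), (f y * H); rewrite mulrDr !mulrA.
have e : D * (f x * Q + G * l i) = (- H) * l j.
  move: sum0; rewrite (bigD1 x) //= GH PDQ => /eqP; rewrite addrA addr_eq0 => /eqP e.
  by rewrite mulNr -e; ring.
have nD : ~ exists g, D = g * l j.
  apply: linear_form_ndvd_prod => // b /and3P[_ bj _].
  by apply: linear_form_ndvd => //; exact: npr.
have [c ec] := linear_form_prime (hl j) (nzl j) e nD.
have /eqP : p (f x) * p Q = 0.
  have : p (f x * Q + G * l i) = 0 by rewrite ec rmorphM pj0 mulr0.
  by rewrite rmorphD !rmorphM pi0 mulr0 addr0.
rewrite mulf_eq0 => /orP[/eqP pf|].
  have [a [b eab]] := pE (f x).
  by exists a, b; rewrite {1}eab pf add0r.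
rewrite rmorph_prod => /prodf_eq0[b nb /eqP pb].
by have [c' [d' e']] := pL _ (hl b) pb; case/asboolP: nb; exists c', d'.
Qed.


(** * Counting the independent 3-dependencies *)

Notation E := {ffun pairs n -> K^o}.

Definition coord_vec (x : pairs n) : E := [ffun y => (y == x)%:R].
Definition eval_omit2 (v : E) : R := \sum_x (v x : K)%:MP * omit2 x.

Lemma eval_omit2P a u v : eval_omit2 (a *: u + v) = a%:MP * eval_omit2 u + eval_omit2 v.
Proof.
rewrite /eval_omit2 big_distrr -big_split /=; apply: eq_bigr => x _.
by rewrite !ffunE mpolyCD mpolyCM mulrDl mulrA.
Qed.

Lemma eval_omit2_0 : eval_omit2 0 = 0.
Proof. by rewrite /eval_omit2 big1 // => x _; rewrite ffunE mpolyC0 mul0r. Qed.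

Lemma eval_coord_vec x : eval_omit2 (coord_vec x) = omit2 x.
Proof.
rewrite /eval_omit2 (bigD1 x) //= ffunE eqxx mpolyC1 mul1r big1 ?addr0 // => y.
by move/negPf=> yx; rewrite ffunE yx mpolyC0 mul0r.
Qed.

(** The relations between the [P_x] are a subspace in the sense of finite
    dimensional spaces even though the values are in an infinite dimensional
    one: take a subspace of relations of maximal dimension. *)
Lemma eval_omit2_ker : exists W : {vspace E}, forall v, v \in W <-> eval_omit2 v = 0.
Proof.
pose P (d : nat) := `[< exists U : {vspace E}, \dim U = d /\
  forall v, v \in U -> eval_omit2 v = 0 >].
have P0 : exists d, P d.
  exists 0%N; apply/asboolP; exists 0%VS; rewrite dimv0; split=> // v.
  by rewrite memv0 => /eqP ->; exact: eval_omit2_0.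
have Pub d : P d -> (d <= \dim {:E})%N.
  by case/asboolP=> U [<- _]; rewrite dimvS ?subvf.
case: (ex_maxnP P0 Pub) => d /asboolP[U [dU kerU]] maxd.
exists U => v; split=> [/kerU //|ev0]; apply: contraT => vU.
have PUv : P (\dim (U + <[v]>)%VS).
  apply/asboolP; exists (U + <[v]>)%VS; split=> // w /memv_addP[u uU [_ /vlineP[a ->] ->]].
  by rewrite addrC eval_omit2P ev0 mulr0 add0r kerU.
have eqU : U = (U + <[v]>)%VS.
  by apply/eqP; rewrite eqEdim addvSl dU maxd.
by move: vU; rewrite eqU (subvP (addvSr U <[v]>)) ?memv_line.
Qed.

Definition mkpair (i j : 'I_n) (ij : (i < j)%N) : pairs n :=
  exist (fun p : 'I_n * 'I_n => (p.1 < p.2)%N) (i, j) ij.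

Lemma dep3_vecE (i1 i2 i3 : 'I_n) (c1 c2 c3 : K)
    (h12 : (i1 < i2)%N) (h13 : (i1 < i3)%N) (h23 : (i2 < i3)%N) :
  dep3_vec i1 i2 i3 c1 c2 c3 =
    c3 *: coord_vec (mkpair h12) + (c2 *: coord_vec (mkpair h13) +
    c1 *: coord_vec (mkpair h23)).
Proof.
have nA (a : 'I_n) : ~~ ((a == i1) && (a == i2)).
  by apply/negP => /andP[/eqP -> /eqP e]; move: h12; rewrite e ltnn.
have nB (b : 'I_n) : ~~ ((b == i2) && (b == i3)).
  by apply/negP => /andP[/eqP -> /eqP e]; move: h23; rewrite e ltnn.
apply/ffunP=> -[[a b] ab]; rewrite !ffunE -!val_eqE /= !xpair_eqE.
move: (nA a) (nB b); case: (a == i1); case: (a == i2); case: (b == i2); case: (b == i3);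
  by rewrite //= /GRing.scale /= ?mulr1 ?mulr0 ?addr0 ?add0r.
Qed.

Lemma omit2_mkpair (i j h : 'I_n) (ij : (i < j)%N) (s : {set 'I_n}) :
  h != i -> h != j -> s = [set i; j; h] ->
  omit2 (mkpair ij) = l h * \prod_(b | b \notin s) l b.
Proof.
move=> hi hj ->; rewrite /omit2 (bigD1 h) /src /tgt /= ?hi ?hj //; congr (_ * _).
by apply: eq_bigl => b; rewrite !inE !negb_or.
Qed.

(** A 3-dependency multiplied by the product of the other forms. *)
Lemma eval_dep3_vec i1 i2 i3 c1 c2 c3 :
  dep3 l i1 i2 i3 c1 c2 c3 -> eval_omit2 (dep3_vec i1 i2 i3 c1 c2 c3) = 0.
Proof.
case=> /andP[h12 h23] _ e; have h13 := ltn_trans h12 h23.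
rewrite (dep3_vecE _ _ _ h12 h13 h23) -[_ *: coord_vec (mkpair h23)]addr0.
rewrite !eval_omit2P eval_omit2_0 addr0 !eval_coord_vec.
pose s := [set i1; i2; i3].
have n12 : i1 != i2 by apply: contraTneq h12 => ->; rewrite ltnn.
have n23 : i2 != i3 by apply: contraTneq h23 => ->; rewrite ltnn.
have n13 : i1 != i3 by apply: contraTneq h13 => ->; rewrite ltnn.
have [n21 n31 n32] : [/\ i2 != i1, i3 != i1 & i3 != i2] by split; rewrite eq_sym.
rewrite (@omit2_mkpair _ _ i3 h12 s) //.
rewrite (@omit2_mkpair _ _ i2 h13 s) //; last by rewrite /s setUAC.
rewrite (@omit2_mkpair _ _ i1 h23 s) //; last by rewrite /s [RHS]setUC setUA.
by rewrite -!mul_mpolyC in e; rewrite -[RHS](mul0r (\prod_(b | b \notin s) l b)) -e; ring.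
Qed.

Lemma dep3_space_eval v : v \in dep3_space l -> eval_omit2 v = 0.
Proof.
have [W WP] := eval_omit2_ker.
have [_ min] := vspanP (fun v => exists (i1 i2 i3 : 'I_n) (c1 c2 c3 : K),
  dep3 l i1 i2 i3 c1 c2 c3 /\ v = dep3_vec i1 i2 i3 c1 c2 c3).
move=> vV; apply/WP; apply: (subvP (min W _)) vV.
by move=> _ [i1 [i2 [i3 [c1 [c2 [c3 [d ->]]]]]]]; apply/WP; exact: eval_dep3_vec.
Qed.

Definition nbc_basis : #|nbc|.-tuple E := [tuple coord_vec (enum_val t) | t < #|nbc|].
Lemma nbc_basisE (t : 'I_#|nbc|) : nbc_basis`_t = coord_vec (enum_val t).
Proof. by rewrite -tnth_nth tnth_mktuple. Qed.

Definition nbc_space : {vspace E} := <<nbc_basis>>%VS.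

Lemma nbc_spaceE v : v \in nbc_space -> forall x, ~~ nbc x -> v x = 0.
Proof.
move/coord_span => -> x nx; rewrite sum_ffunE big1 // => t _.
rewrite nbc_basisE !ffunE; case: eqP => [ex|_]; last by rewrite scaler0.
by case/negP: nx; rewrite ex; exact: (enum_valP t).
Qed.

Lemma dim_nbc_space : \dim nbc_space = #|nbc|.
Proof.
have: free nbc_basis.
  apply/freeP => c; under eq_bigr do rewrite nbc_basisE.
  move=> c0 t; move/ffunP/(_ (enum_val t)): c0.
  rewrite sum_ffunE (bigD1 t) //= big1 => [|s st].
    rewrite addr0 !ffunE eqxx.
    by rewrite /GRing.scale /= mulr1.
  rewrite !ffunE (inj_eq enum_val_inj) eq_sym (negPf st).
  by rewrite scaler0.
by rewrite /free size_tuple => /eqP.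
Qed.

(** Induction on the smaller index: if [l_h] is in the span of [l_i] and [l_j]
    with [h < i], the dependency of these three forms expresses the vector of
    [(i, j)] through those of [(h, i)] and [(h, j)]. *)
Lemma coord_vec_span x : coord_vec x \in (dep3_space l + nbc_space)%VS.
Proof.
have [m] := ubnP (src x : nat); elim: m => // m IH in x *; rewrite ltnS => xm.
case: (boolP (nbc x)) => [nx|].
  apply: (subvP (addvSr _ _)); apply: memv_span.
  apply/tnthP; exists (enum_rank_in nx x); rewrite tnth_mktuple.
  by rewrite enum_rankK_in.
rewrite negb_forall => /existsP[h]; rewrite negb_imply negbK => /andP[hi].
case/asboolP=> c [d e]; have ij := src_lt_tgt x; have hj := ltn_trans hi ij.
have nhj : h != tgt x by apply: contraTneq hj => ->; rewrite ltnn.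
have nhi : h != src x by apply: contraTneq hi => ->; rewrite ltnn.
have nzc : c != 0.
  by apply: contraNneq (npr nhj d) => c0; rewrite e c0 scale0r add0r.
have nzd : d != 0.
  by apply: contraNneq (npr nhi c) => d0; rewrite e d0 scale0r addr0.
have dep : dep3 l h (src x) (tgt x) 1 (- c) (- d).
  split; first by rewrite hi ij.
    by rewrite !oppr_eq0 oner_eq0 nzc nzd.
  by rewrite e scale1r !scaleNr addrAC addrK subrr.
have /(subvP (addvSl _ nbc_space)) vin : dep3_vec h (src x) (tgt x) 1 (- c) (- d) \in dep3_space l.
  by apply: (proj1 (vspanP _)); exists h, (src x), (tgt x), 1, (- c), (- d).
have -> : coord_vec x = dep3_vec h (src x) (tgt x) 1 (- c) (- d) +
    (d *: coord_vec (mkpair hi) + c *: coord_vec (mkpair hj)).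
  rewrite (dep3_vecE _ _ _ hi hj ij) scale1r !scaleNr.
  have -> : mkpair ij = x by apply/val_inj; rewrite /= -surjective_pairing.
  by rewrite (addrA (- _)) -opprD addrAC addNr add0r.
have hm : (h < m)%N by exact: leq_trans xm.
by rewrite rpredD // rpredD // rpredZ // IH.
Qed.

(** A vector in the intersection is a syzygy with constant coefficients of the
    basic [P_x]; by [nbc_syzygy] these constants lie in proper homogeneous
    ideals, so they vanish. *)
Lemma dep3_nbc_direct : (dep3_space l :&: nbc_space = 0)%VS.
Proof.
apply/eqP; rewrite -subv0; apply/subvP => v; rewrite memv_cap memv0 => /andP[vV vN].
apply/eqP/ffunP => x; rewrite ffunE.
case: (boolP (nbc x)) => [nx|/(nbc_spaceE vN) //].
have sum0 : \sum_(y | nbc y) (v y : K)%:MP * omit2 y = 0.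
  rewrite -[RHS](dep3_space_eval vV) /eval_omit2 [RHS](bigID nbc) /= [X in _ + X]big1 ?addr0 // => y.
  by move/(nbc_spaceE vN) => ->; rewrite mpolyC0 mul0r.
have [a [b /= eab]] := nbc_syzygy sum0 nx.
have ts : tgt x != src x by rewrite eq_sym src_neq_tgt.
have [p [p1 p2 pC _ _]] := plane_elimination (hl _) (hl (tgt x)) (nzl (src x)) (npr ts).
have : p (v x : K)%:MP = 0 by rewrite eab rmorphD !rmorphM p1 p2 !mulr0 addr0.
by rewrite pC => /eqP; rewrite mpolyC_eq0 => /eqP.
Qed.

Lemma dep3_nbc_full : (dep3_space l + nbc_space)%VS = fullv.
Proof.
apply/eqP; rewrite eqEsubv subvf /=; apply/subvP => v _.
have -> : v = \sum_x v x *: coord_vec x.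
  apply/ffunP=> x; rewrite sum_ffunE (bigD1 x) //= big1 => [|y yx].
    by rewrite !ffunE eqxx addr0 /GRing.scale /= mulr1.
  by rewrite !ffunE eq_sym (negPf yx) scaler0.
by apply: rpred_sum => x _; rewrite rpredZ // coord_vec_span.
Qed.

(** The space of 3-dependencies and the space of the basic pairs are
    complementary in [K^m]. *)
Lemma dep3_rankE : (dep3_rank l + #|nbc| = 'C(n, 2))%N.
Proof.
rewrite -dim_nbc_space -dimv_disjoint_sum ?dep3_nbc_direct // dep3_nbc_full.
by rewrite dimvf -card_pairs /dim /= muln1.
Qed.

Lemma omit2_nbc_span x : exists c : pairs n -> R, omit2 x = \sum_(y | nbc y) c y * omit2 y.
Proof.
have /memv_addP[u uV [v vN e]] := coord_vec_span x.
exists (fun y => (v y : K)%:MP).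
rewrite -eval_coord_vec e -[u]scale1r eval_omit2P dep3_space_eval // mulr0 add0r.
rewrite /eval_omit2 (bigID nbc) /= [X in _ + X]big1 ?addr0 // => y.
by move/(nbc_spaceE vN) => ->; rewrite mpolyC0 mul0r.
Qed.
End Arrangement.

(** * Kernels of constant matrices, and degrees *)

Section ConstantMatrices.
Variables (K : fieldType) (k : nat).
Notation R := {mpoly K[k]}.
Notation cst A := (map_mx (@mpolyC k K) A).

(** A basis [B] of the kernel of [A] with a splitting.  The last identity is
    polynomial in the entries, so it survives extension of scalars to the
    polynomial ring, where it shows that [B] is still a basis of the kernel
    ([split_kernel_mpoly]). *)
Lemma split_kernel p q (A : 'M[K]_(p, q)) :
  exists r (B : 'M[K]_(r, p)) (C : 'M[K]_(p, r)) (D : 'M[K]_(q, p)),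
    r = (p - \rank A)%N /\
    [/\ B *m A = 0, B *m C = 1%:M & A *m D + C *m B = 1%:M].
Proof.
(* 1 - A D kills A on the left, hence factors through the kernel. *)
pose D := pinvmx A; pose B := row_base (kermx A).
have BA : B *m A = 0 by apply/sub_kermxP; rewrite eq_row_base.
have /submxP[C CB] : (1%:M - A *m D <= B)%MS.
  rewrite eq_row_base; apply/sub_kermxP.
  by rewrite mulmxBl mul1mx mulmxKpV // subrr.
exists _, B, C, D; split; first exact: mxrank_ker.
split=> //; last by rewrite -CB addrC subrK.
have /row_freeP[B' BB'] : row_free B by exact: row_base_free.
have e : B *m C *m B = B.
  by rewrite -mulmxA -CB mulmxBr mulmx1 mulmxA BA mul0mx subr0.
by rewrite -[LHS]mulmx1 -BB' mulmxA e.
Qed.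

Lemma split_kernel_mpoly p q r s (A : 'M[K]_(p, q)) (B : 'M[K]_(r, p))
    (C : 'M[K]_(p, r)) (D : 'M[K]_(q, p)) (v : 'M[R]_(s, p)) :
  A *m D + C *m B = 1%:M -> v *m cst A = 0 -> v = v *m cst C *m cst B.
Proof.
move=> e vA; rewrite -[LHS]mulmx1 -(map_mx1 (@mpolyC k K)) -e map_mxD !map_mxM.
by rewrite mulmxDr !mulmxA vA mul0mx add0r.
Qed.

Definition mxhomog d m n (A : 'M[R]_(m, n)) := forall i j, A i j \is d.-homog.

Lemma mxhomog_const m n (A : 'M[K]_(m, n)) : mxhomog 0 (cst A).
Proof. by move=> i j; rewrite mxE -[_%:MP]mulr1 mul_mpolyC rpredZ // dhomog1. Qed.

Lemma mxhomogM d e m n p (A : 'M[R]_(m, n)) (B : 'M[R]_(n, p)) :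
  mxhomog d A -> mxhomog e B -> mxhomog (d + e)%N (A *m B).
Proof.
by move=> hA hB i j; rewrite mxE rpred_sum // => s _; apply: dhomogM.
Qed.

Lemma homog_ringM d e (f g : R) :
  homog_ring d f -> g \is e.-homog -> homog_ring (d + e%:Z) (f * g).
Proof.
case: d => d /= hf hg; first exact: dhomogM.
by rewrite hf mul0r; case: (_ + _) => // a; exact: dhomog0.
Qed.

Lemma homog_ring_sum d (I : finType) (F : I -> R) :
  (forall i, homog_ring d (F i)) -> homog_ring d (\sum_i F i).
Proof.
case: d => d hF; first by apply: rpred_sum => i _; exact: hF.
by rewrite /= big1 // => i _; exact: hF.
Qed.

Lemma mulmx_degree0 b c b' c' e (M : 'M[R]_(b, b')) :
  mxhomog e M -> c = (c' + e)%N ->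
  degree0 (homog_free c) (homog_free c') (mulmxr M).
Proof.
move=> hM -> d v hv j; rewrite /= mxE; apply: homog_ring_sum => i.
have -> : d - c'%:Z = d - (c' + e)%N%:Z + e%:Z.
  by rewrite PoszD opprD addrA subrK.
exact: homog_ringM.
Qed.

Definition mul_col b (P : 'cV[R]_b) (v : 'rV[R]_b) : R^o := (v *m P) 0 0.

Lemma mul_col_is_linear b (P : 'cV[R]_b) : linear (mul_col P).
Proof. by move=> a u v; rewrite /mul_col mulmxDl -scalemxAl !mxE. Qed.
HB.instance Definition _ b (P : 'cV[R]_b) :=
  GRing.isLinear.Build R 'rV[R]_b R^o *:%R (mul_col P) (mul_col_is_linear P).

Lemma mul_colE b (P : 'cV[R]_b) (v : 'rV[R]_b) : v *m P = (mul_col P v)%:M.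
Proof. by apply/matrixP=> i j; rewrite !ord1 [RHS]mxE eqxx mulr1n. Qed.

Lemma mul_col_degree0 b c (P : 'cV[R]_b) :
  mxhomog c P -> degree0 (homog_free c) (@homog_ring K k) (mul_col P).
Proof.
move=> hP d v hv; rewrite /mul_col mxE; apply: homog_ring_sum => i.
rewrite -[d](subrK c%:Z). exact: homog_ringM (hv i) (hP i 0).
Qed.
End ConstantMatrices.

(** * The complex *)

Section Complex.
Variables (K : fieldType) (k n : nat) (l : 'I_n -> {mpoly K[k]}).
Hypothesis arrl : arrangement l.
Hypothesis n_ge2 : (2 <= n)%N.
Notation R := {mpoly K[k]}.
Notation cst A := (map_mx (@mpolyC k K) A).
Notation N := #|nbc l|.

Let hl i : l i \is 1.-homog. Proof. by case: arrl. Qed.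
Let nzl i : l i != 0. Proof. by case: arrl. Qed.
Let npr i j : i != j -> forall c : K, l i != c *: l j.
Proof. by case: arrl => _ _; apply. Qed.

Definition nsrc (t : 'I_N) : 'I_n := src (enum_val t).
Definition ntgt (t : 'I_N) : 'I_n := tgt (enum_val t).

Definition src_mx : 'M[K]_(N, n) := \matrix_(t, h) (h == nsrc t)%:R.
Definition tgt_mx : 'M[K]_(N, n) := \matrix_(t, h) (h == ntgt t)%:R.
(** The basic pairs are the edges of a graph on the indices of the forms. *)
Definition boundary_mx : 'M[K]_(N, n) := src_mx - tgt_mx.
(** The first block of rows is for the Koszul generators mapping to [l_i], the
    second for those mapping to [l_j]; they go to [e_j] and [e_i] respectively,
    since [l_i P_ij = P_j] and [l_j P_ij = P_i]. *)
Definition incidence_mx : 'M[K]_(N + N, n) := col_mx tgt_mx src_mx.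

Definition form_mx : 'M[R]_n := diag_mx (\row_h l h).
Definition form_src : 'M[R]_N := diag_mx (\row_t l (nsrc t)).
Definition form_tgt : 'M[R]_N := diag_mx (\row_t l (ntgt t)).
Definition koszul2 : 'M[R]_(N, N + N) := row_mx (- form_tgt) form_src.
Definition koszul1 : 'M[R]_(N + N, N) := col_mx form_src form_tgt.
Definition omit2_col : 'cV[R]_N := \col_t omit2 l (enum_val t).
Definition omit1_col : 'cV[R]_n := \col_h omit1 l h.

Lemma form_srcE : form_src *m cst src_mx = cst src_mx *m form_mx.
Proof.
rewrite mul_diag_mx mul_mx_diag; apply/matrixP=> t h; rewrite !mxE.
by case: eqP => [->|_]; rewrite ?mpolyC1 ?mpolyC0 ?mulr0 ?mul0r // mulrC.
Qed.

Lemma form_tgtE : form_tgt *m cst tgt_mx = cst tgt_mx *m form_mx.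
Proof.
rewrite mul_diag_mx mul_mx_diag; apply/matrixP=> t h; rewrite !mxE.
by case: eqP => [->|_]; rewrite ?mpolyC1 ?mpolyC0 ?mulr0 ?mul0r // mulrC.
Qed.

(** With [koszul1_omit2]: the constant matrices form a map from the sum of the
    Koszul complexes to the resolution of the module generated by the [P_h]. *)
Lemma koszul2_incidence :
  koszul2 *m cst incidence_mx = cst boundary_mx *m form_mx.
Proof.
rewrite map_col_mx mul_row_col mulNmx form_srcE form_tgtE addrC.
by rewrite map_mxB mulmxBl.
Qed.

Lemma koszul_complex : koszul2 *m koszul1 = 0.
Proof.
rewrite mul_row_col mulNmx addrC; apply/eqP; rewrite subr_eq0; apply/eqP.
rewrite !mul_diag_mx; apply/matrixP=> s t; rewrite !mxE.
by case: eqP => [->|_]; rewrite ?mulr0n ?mulr0 // !mulr1n mulrC.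
Qed.

Lemma omit2_src (x : pairs n) : l (src x) * omit2 l x = omit1 l (tgt x).
Proof.
rewrite /omit1 (bigD1 (src x)) ?src_neq_tgt //=; congr (_ * _).
by apply: eq_bigl => h; rewrite andbC.
Qed.

Lemma omit2_tgt (x : pairs n) : l (tgt x) * omit2 l x = omit1 l (src x).
Proof. by rewrite [RHS](bigD1 (tgt x)) // eq_sym src_neq_tgt. Qed.

Lemma select_col m (f : 'I_m -> 'I_n) :
  cst (\matrix_(t < m, h < n) (h == f t)%:R) *m omit1_col = \col_t omit1 l (f t).
Proof.
apply/matrixP=> t j; rewrite !mxE (bigD1 (f t)) //= !mxE eqxx mpolyC1 mul1r.
by rewrite big1 ?addr0 // => h /negPf hf; rewrite !mxE hf mpolyC0 mul0r.
Qed.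

Lemma koszul1_omit2 : koszul1 *m omit2_col = cst incidence_mx *m omit1_col.
Proof.
rewrite map_col_mx !mul_col_mx; rewrite [tgt_mx]/tgt_mx [src_mx]/src_mx !select_col.
rewrite !mul_diag_mx; congr col_mx; apply/matrixP=> t j; rewrite !mxE.
  exact: omit2_src.
exact: omit2_tgt.
Qed.

Lemma koszul2_inj m (u : 'M[R]_(m, N)) : u *m koszul2 = 0 -> u = 0.
Proof.
rewrite mul_mx_row -[0]row_mx0 => /eq_row_mx[_]; rewrite mul_mx_diag => /matrixP e.
apply/matrixP=> s t; move: (e s t); rewrite !mxE => /eqP.
by rewrite mulf_eq0 (negPf (nzl _)) orbF => /eqP.
Qed.

Lemma form_mx_inj m (u : 'M[R]_(m, n)) : u *m form_mx = 0 -> u = 0.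
Proof.
rewrite mul_mx_diag => /matrixP e.
apply/matrixP=> s t; move: (e s t); rewrite !mxE => /eqP.
by rewrite mulf_eq0 (negPf (nzl _)) orbF => /eqP.
Qed.

Lemma koszul1_exact (w : 'rV[R]_(N + N)) :
  w *m koszul1 = 0 -> exists u : 'rV[R]_N, w = u *m koszul2.
Proof.
rewrite -[w]hsubmxK; set a := lsubmx w; set b := rsubmx w.
rewrite mul_row_col !mul_mx_diag => /matrixP e.
have ex t : exists u, a 0 t = - (u * l (ntgt t)) /\ b 0 t = u * l (nsrc t).
  apply: koszul_exact => //; first by apply: npr; rewrite eq_sym src_neq_tgt.
  by move: (e 0 t); rewrite !mxE.
exists (\row_t projT1 (cid (ex t))).
rewrite mul_mx_row mulmxN !mul_mx_diag; congr row_mx; apply/matrixP => i t;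
  rewrite !ord1 !mxE; by case: cid => u /= []; rewrite !mxE.
Qed.

(** [nbc_syzygy] in matrix form: a syzygy of the [P_ij] is a Koszul boundary. *)
Lemma omit2_exact (f : 'rV[R]_N) :
  f *m omit2_col = 0 -> exists w, f = w *m koszul1.
Proof.
move/matrixP/(_ 0 0); rewrite !mxE => e.
have [g gE] : exists g : pairs n -> R, forall t, g (enum_val t) = f 0 t.
  exists (fun x => if [pick t : 'I_N | enum_val t == x] is Some t then f 0 t else 0).
  move=> t; case: pickP => [s /eqP /enum_val_inj -> //|/(_ t)].
  by rewrite eqxx.
have sum0 : \sum_(x | nbc l x) g x * omit2 l x = 0.
  rewrite -[RHS]e (eq_bigl (fun x => x \in nbc l)) //.
  by rewrite big_enum_val /=; apply: eq_bigr => t _; rewrite gE mxE.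
have ex t : exists ab : R * R, f 0 t = ab.1 * l (nsrc t) + ab.2 * l (ntgt t).
  have [a [b eab]] := nbc_syzygy arrl sum0 (enum_valP t).
  by exists (a, b); rewrite -gE eab.
exists (row_mx (\row_t (projT1 (cid (ex t))).1) (\row_t (projT1 (cid (ex t))).2)).
rewrite mul_row_col !mul_mx_diag; apply/matrixP=> i t; rewrite !ord1 !mxE.
by case: cid.
Qed.

(** Modulo [l_h] only [P_h] survives, and it is prime to [l_h]; so the coefficient
    of [P_h] is a multiple of [l_h]. *)
Lemma omit1_exact (y : 'rV[R]_n) : y *m omit1_col = 0 ->
  exists2 z, y = z *m form_mx & \sum_h z 0 h = 0.
Proof.
move/matrixP/(_ 0 0); rewrite !mxE => e.
have ex h : exists z, y 0 h = z * l h.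
  have eh : omit1 l h * y 0 h =
      (- \sum_(g | g != h) y 0 g * \prod_(b | (b != g) && (b != h)) l b) * l h.
    move: e; rewrite (bigD1 h) //= mxE => /eqP; rewrite addr_eq0 => /eqP.
    rewrite mulrC => ->; rewrite mulNr big_distrl /=; congr (- _).
    apply: eq_bigr => g gh; rewrite mxE -mulrA; congr (_ * _).
    by rewrite /omit1 (bigD1 h) 1?eq_sym //= mulrC.
  apply: linear_form_prime eh _ => //.
  apply: linear_form_ndvd_prod => // g gh.
  by apply: linear_form_ndvd => //; exact: npr.
pose z := \row_h projT1 (cid (ex h)).
have zE h : y 0 h = z 0 h * l h by rewrite mxE; case: cid.
exists z; first by rewrite mul_mx_diag; apply/matrixP=> i h; rewrite ord1 zE !mxE.
have : (\sum_h z 0 h) * \prod_h l h = 0.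
  rewrite -[RHS]e big_distrl; apply: eq_bigr => h _ /=.
  by rewrite zE [omit1_col _ _]mxE -mulrA; congr (_ * _); rewrite (bigD1 h).
move/eqP; rewrite mulf_eq0 => /orP[/eqP //|].
by move/prodf_eq0 => [h _]; rewrite (negPf (nzl h)).
Qed.

(** The pairs [(0, h)] are all basic, and form a spanning tree of the graph. *)
Let o : 'I_n := Ordinal (ltnW n_ge2).
Let o1 : 'I_n := Ordinal n_ge2.

Lemma star_sum (F : 'I_n -> 'I_n -> K) h :
  \sum_(t < N) (val (enum_val t) == (o, h))%:R * F (nsrc t) (ntgt t) =
    (h != o)%:R * F o h.
Proof.
have [->|ho] := eqVneq h o.
  rewrite mul0r big1 // => t _; case: eqP => [e|_]; last by rewrite mul0r.
  by move: (src_lt_tgt (enum_val t)); rewrite /src /tgt e ltnn.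
have oh : (o < h)%N by rewrite lt0n -(inj_eq val_inj) in ho *.
have nx : mkpair oh \in nbc l by apply/forallP => g; rewrite ltn0.
rewrite (bigD1 (enum_rank_in nx (mkpair oh))) //= enum_rankK_in // eqxx.
rewrite /nsrc /ntgt enum_rankK_in // big1 ?addr0 // => t tn.
case: eqP => [e|_]; last by rewrite mul0r.
case/eqP: tn; apply: enum_val_inj; rewrite enum_rankK_in //; exact: val_inj.
Qed.

(** Sends [e_h] to the edge from the root to [h]; the root itself goes to zero,
    as the pair [(0, 0)] is not an edge. *)
Definition star_mx : 'M[K]_(n, N) :=
  \matrix_(h, t) (val (enum_val t) == (o, h))%:R.

Lemma star_boundary :
  - star_mx *m boundary_mx = 1%:M - const_mx 1 *m delta_mx (0 : 'I_1) o.
Proof.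
apply/matrixP=> h g; rewrite mulNmx !mxE big_ord1 !mxE eqxx mul1r /=.
under eq_bigr => t _ do rewrite !mxE.
rewrite (star_sum (fun a b => (g == a)%:R - (g == b)%:R)).
have [->|ho] /= := eqVneq h o; first by rewrite mul0r oppr0 eq_sym subrr.
by rewrite mul1r opprB [h == g]eq_sym.
Qed.

Lemma boundary_exact (z : 'rV[R]_n) :
  \sum_h z 0 h = 0 -> exists u, z = u *m cst boundary_mx.
Proof.
move=> z0; exists (z *m cst (- star_mx)).
rewrite -mulmxA -map_mxM star_boundary map_mxB map_mx1 mulmxBr mulmx1 map_mxM.
rewrite mulmxA [z *m cst _](_ : _ = 0) ?mul0mx ?subr0 //.
apply/matrixP=> i j; rewrite !mxE !ord1 -[RHS]z0; apply: eq_bigr => h _.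
by rewrite !mxE mpolyC1 mulr1.
Qed.

Lemma rank_boundary : \rank boundary_mx = n.-1.
Proof.
apply/eqP; rewrite eqn_leq; apply/andP; split.
  have b0 : boundary_mx *m const_mx 1 = 0 :> 'cV[K]_N.
    rewrite mulmxBl; apply/eqP; rewrite subr_eq0; apply/eqP.
    apply/matrixP=> t j; rewrite !mxE (bigD1 (nsrc t)) //= [RHS](bigD1 (ntgt t)) //=.
    by rewrite !mxE !eqxx !big1 // => h /negPf hn; rewrite !mxE hn mul0r.
  have := mulmx0_rank_max b0; suff -> : \rank (const_mx 1 : 'cV[K]_n) = 1%N.
    by rewrite -subn1 leq_subRL ?(ltnW n_ge2) // addnC.
  apply/eqP; rewrite eqn_leq rank_leq_col lt0n mxrank_eq0.
  by apply/eqP => /matrixP/(_ o 0)/eqP; rewrite !mxE oner_eq0.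
have : (\rank (1%:M : 'M[K]_n) <= \rank boundary_mx + 1)%N.
  have e : 1%:M = - star_mx *m boundary_mx + const_mx 1 *m delta_mx (0 : 'I_1) o.
    by rewrite star_boundary subrK.
  rewrite e; apply: leq_trans (mxrank_add _ _) (leq_add (mxrankM_maxr _ _) _).
  exact: leq_trans (mxrankM_maxl _ _) (rank_leq_col _).
by rewrite mxrank1 -subn1 leq_subLR addnC.
Qed.

Lemma rank_incidence : \rank incidence_mx = n.
Proof.
apply/eqP/row_fullP.
(* the root is the smaller end of the edge (0, 1) *)
pose T : 'M[K]_(n, N) :=
  \matrix_(h, t) ((h == o)%:R * (val (enum_val t) == (o, o1))%:R).
exists (row_mx star_mx T); rewrite mul_row_col; apply/matrixP=> h g; rewrite !mxE.
under eq_bigr => t _ do rewrite !mxE.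
rewrite (star_sum (fun _ b => (g == b)%:R)).
under eq_bigr => t _ do rewrite !mxE -mulrA.
rewrite -big_distrr /= (star_sum (fun a _ => (g == a)%:R)).
have -> : (o1 != o) by [].
have [->|ho] := eqVneq h o; rewrite ?mul0r ?mul1r ?add0r ?addr0 eq_sym //.
Qed.

Lemma omit2_homog x : omit2 l x \is (n - 2).-homog.
Proof.
have -> : (n - 2 = \sum_(h | (h != src x) && (h != tgt x)) 1)%N.
  rewrite sum1_card -[n in LHS]card_ord -(cardC (pred2 (src x) (tgt x))).
  rewrite card2 src_neq_tgt addKn; apply: eq_card => h.
  by rewrite !inE negb_or.
apply: (big_rec2 (fun d (f : R) => f \is d.-homog)); first exact: dhomog1.
by move=> h d f _ hf; exact: dhomogM.
Qed.

Lemma fold_omit2 S : exists x, fold_products l (n - 2) S = omit2 l x.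
Proof.
case: S => S /= cS; have : #|~: S| == 2.
  by move: cS; rewrite [#|S|]cardsCs card_ord => /eqP e; apply/eqP;
    rewrite -(subKn (max_card (mem (~: S)))) card_ord e subKn.
move/cards2P=> [i [j [ij eS]]].
have inS h : h \in S = (h != i) && (h != j).
  by rewrite -[h \in S]negbK -in_setC eS !inE negb_or.
have [ltij|ltji|/val_inj eij] := ltngtP i j; last by rewrite eij eqxx in ij.
  by exists (mkpair ltij); apply: eq_bigl => h; rewrite inS.
by exists (mkpair ltji); apply: eq_bigl => h; rewrite inS andbC.
Qed.

Lemma omit2_fold x : exists S, omit2 l x = fold_products l (n - 2) S.
Proof.
have cS : #|~: [set src x; tgt x]| == (n - 2)%N.
  by rewrite cardsCs setCK cards2 src_neq_tgt card_ord.
exists (exist (fun S : {set 'I_n} => #|S| == (n - 2)%N) _ cS); apply: eq_bigl => h /=.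
by rewrite !inE negb_or.
Qed.

Lemma omit2_col_ideal f : f \in ideal_gen (fold_products l (n - 2)) <->
  exists v, mul_col omit2_col v = f.
Proof.
pose P f := exists v, mul_col omit2_col v = f.
have P0 : P 0 by exists 0; rewrite raddf0.
have PD f1 f2 : P f1 -> P f2 -> P (f1 + f2).
  by move=> [v1 <-] [v2 <-]; exists (v1 + v2); rewrite raddfD.
have PM c f1 : P f1 -> P (c * f1).
  by move=> [v <-]; exists (c *: v); rewrite linearZ.
have Pn y : nbc l y -> P (omit2 l y).
  move=> ny; exists (delta_mx 0 (enum_rank_in ny y)).
  by rewrite /mul_col -rowE !mxE enum_rankK_in.
split=> [/ideal_genP[c ->]|[v <-]].
  apply: (big_ind P) => // S _; apply: (PM); have [x ->] := fold_omit2 S.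
  have [c' ->] := omit2_nbc_span arrl x.
  by apply: (big_ind P) => // y ny; apply: (PM); exact: Pn.
rewrite /mul_col mxE; apply: rpred_sum => t _; apply: ideal_genM; rewrite mxE.
by have [S ->] := omit2_fold (enum_val t); exact: ideal_gen_mem.
Qed.

(** The diagram chase, with [B1] and [B2] bases of the kernels of the incidence
    and boundary matrices; the differentials are the Koszul ones restricted to
    these kernels, and [C1] computes coordinates in the basis [B1]. *)
Lemma fold_resolution : exists b3 b2 : nat,
  [/\ b3 = (N - n.-1)%N, b2 = (N + N - n)%N &
    has_graded_resolution (fold_products l (n - 2)) b3 n b2 (n - 1) N (n - 2)].
Proof.
have [b3 [B2 [C2 [D2 [rb3 [B2k BC2 split2]]]]]] := split_kernel boundary_mx.
have [b2 [B1 [C1 [D1 [rb2 [B1k BC1 split1]]]]]] := split_kernel incidence_mx.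
exists b3, b2; split; [by rewrite rb3 rank_boundary|by rewrite rb2 rank_incidence|].
pose M3 := cst B2 *m koszul2 *m cst C1; pose M2 := cst B1 *m koszul1.
have hM3 : mxhomog (0 + 1 + 0)%N M3.
  rewrite /M3; apply: mxhomogM (mxhomog_const k C1).
  apply: mxhomogM; first exact: mxhomog_const.
  move=> i j; rewrite !mxE; case: split => s; rewrite !mxE ?rpredN;
    by apply: rpredMn; exact: hl.
have hM2 : mxhomog (0 + 1)%N M2.
  apply: mxhomogM; first exact: mxhomog_const.
  move=> i j; rewrite !mxE; case: split => s; rewrite !mxE;
    by apply: rpredMn; exact: hl.
have hM1 : mxhomog (n - 2) omit2_col by move=> i j; rewrite mxE omit2_homog.
have M3B : M3 *m cst B1 = cst B2 *m koszul2.
  apply/esym/(split_kernel_mpoly split1).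
  by rewrite -mulmxA koszul2_incidence mulmxA -map_mxM B2k map_mx0 mul0mx.
have cBC1 (v : 'rV[R]_b2) : v *m cst B1 *m cst C1 = v.
  by rewrite -mulmxA -map_mxM BC1 map_mx1 mulmx1.
have cBC2 (v : 'rV[R]_b3) : v *m cst B2 *m cst C2 = v.
  by rewrite -mulmxA -map_mxM BC2 map_mx1 mulmx1.
exists (mulmxr M3), (mulmxr M2), (mul_col omit2_col); split; split.
- by apply: mulmx_degree0 hM3 _; lia.
- by apply: mulmx_degree0 hM2 _; lia.
- exact: mul_col_degree0.
- by move=> d f hf; exists f.
- apply: raddf_inj => v /= vM3.
  have /koszul2_inj v0 : (v *m cst B2) *m koszul2 = 0.
    by rewrite -mulmxA -M3B mulmxA vM3 mul0mx.
  by rewrite -[v]cBC2 v0 mul0mx.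
- move=> v /=; split=> [|[u <-]]; last first.
    by rewrite -mulmxA (mulmxA M3) M3B -mulmxA koszul_complex !mulmx0.
  rewrite mulmxA => /koszul1_exact[u eu].
  have /form_mx_inj : u *m cst boundary_mx *m form_mx = 0.
    by rewrite -mulmxA -koszul2_incidence mulmxA -eu -mulmxA -map_mxM B1k map_mx0 mulmx0.
  move/(split_kernel_mpoly split2) => eu2.
  exists (u *m cst C2); rewrite -[v]cBC1 eu {2}eu2.
  by rewrite !mulmxA.
- move=> v /=; split=> [v0|[u <-]]; last first.
    rewrite /mul_col -!mulmxA koszul1_omit2 (mulmxA (cst B1)) -map_mxM B1k.
    by rewrite map_mx0 mul0mx mulmx0 mxE.
  have vP : v *m omit2_col = 0 by rewrite mul_colE v0 raddf0.
  have [w ew] := omit2_exact vP.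
  have [z ez z0] : exists2 z, w *m cst incidence_mx = z *m form_mx & \sum_h z 0 h = 0.
    by apply: omit1_exact; rewrite -mulmxA -koszul1_omit2 mulmxA -ew.
  have [u eu] := boundary_exact z0.
  have /(split_kernel_mpoly split1) e : (w - u *m koszul2) *m cst incidence_mx = 0.
    by rewrite mulmxBl ez -mulmxA koszul2_incidence mulmxA -eu subrr.
  exists ((w - u *m koszul2) *m cst C1).
  by rewrite mulmxA -e mulmxBl -ew -mulmxA koszul_complex mulmx0 subr0.
- move=> f; rewrite -omit2_col_ideal; split=> [f0|fI].
    rewrite -[f]subr0; apply/quot_pi_eq; rewrite f0; exact/esym/raddf0.
  by rewrite -[RHS](raddf0 (quot_pi (fold_products l (n - 2)))); apply/quot_pi_eq; rewrite subr0.
- exact: quot_pi_surj.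
Qed.

End Complex.

Theorem theorem2p4 (K : fieldType) (charK0 : [pchar K] =i pred0)
  (k n : nat) (n_ge2 : (2 <= n)%N)
  (l : 'I_n -> {mpoly K[k]}) (l_arr : arrangement l) :
  let m := 'C(n, 2) in
  let p := dep3_rank l in
  exists b3 b2 b1 : nat,
    [/\ b3%:Z = m%:Z - n%:Z - p%:Z + 1,
        b2%:Z = 2 * m%:Z - n%:Z - 2 * p%:Z,
        b1%:Z = m%:Z - p%:Z
      & has_graded_resolution (fold_products l (n - 2)%N)
          b3 n b2 (n - 1)%N b1 (n - 2)%N].
Proof.
move=> m p; have mE : m = (p + #|nbc l|)%N by rewrite dep3_rankE.
have [b3 [b2 [b3E b2E res]]] := fold_resolution l_arr n_ge2.
have le3 : (n.-1 <= #|nbc l|)%N by rewrite -(rank_boundary l n_ge2) rank_leq_row.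
have le2 : (n <= #|nbc l| + #|nbc l|)%N by rewrite -[n in (n <= _)%N](rank_incidence l n_ge2) rank_leq_row.
exists b3, b2, #|nbc l|; split=> //; lia.
Qed.
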